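(* Let $G$ be a flat affine algebraic group scheme over a commutative ring $k$. The following two statements are equivalent: (a) $G$ is power reductive of degree one. (b) $G$ is linearly reductive.
   Context: All rings are unital. ''Algebraic'' means of finite type over $k$. A $G$-module is a $k$-module $V$ together with, functorially in $k$-algebras $A$, an $A$-linear action of $G(A)$ on $V\otimes_k A$; equivalently, a comodule $\Delta_V: V\to V\otimes_k k[G]$ over the Hopf algebra $k[G]$. The invariants are $V^G=\{v\in V\mid \Delta_V(v)=v\otimes 1\}$. $G$ is power reductive of degree one if every surjective $G$-module homomorphism $\varphi: M\to k$ (with $k$ the trivial $G$-module) splits, i.e. $\ker(\varphi)$ has a $G$-stable complement in $M$. (This is the case $d=1$ of power reductivity, which asks that for each such $\varphi$ there be a positive integer $d$ such that $\ker(S^d(\varphi))$ has a $G$-stable complement in $S^d(M)$.) $G$ is linearly reductive if $H^1(G,V)=0$ for all $G$-modules $V$, where $H^1$ is Hochschild cohomology, i.e. the first right derived functor of $V\mapsto V^G$ on the category of $G$-modules. *)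

(* Defs.v *)
From HB Require Import structures.
From mathcomp Require Import all_boot all_algebra.
From mathcomp Require Import boolp.

Set Implicit Arguments.
Unset Strict Implicit.
Unset Printing Implicit Defensive.

Import GRing.Theory.
Local Open Scope ring_scope.
Local Open Scope quotient_scope.

(* The library has no tensor product of modules over a commutative ring.  Here
   U ⊗ V is a quotient of the formal finite sums of pairs (u, v): two formal
   sums are identified when every bilinear map takes the same value on them.
   The lemmas tensr_bilin, tliftE, tlift_linear and tensorW below say that this
   has the universal property of the tensor product. *)
Section Tensor.
Variables (k : comPzRingType) (U V : lmodType k).

Definition bilin (W : lmodType k) (f : U -> V -> W) : Prop :=
  (forall v, linear (f^~ v)) /\ (forall u, linear (f u)).

Definition teval (W : lmodType k) (f : U -> V -> W) (s : seq (U * V)) : W :=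
  \sum_(p <- s) f p.1 p.2.

Definition teq (s t : seq (U * V)) : bool :=
  `[< forall (W : lmodType k) (f : U -> V -> W), bilin f ->
        teval f s = teval f t >].

Lemma teqP s t : reflect (forall (W : lmodType k) (f : U -> V -> W), bilin f ->
  teval f s = teval f t) (teq s t).
Proof. exact: asboolP. Qed.

Fact teq_refl : reflexive teq.
Proof. by move=> s; apply/teqP. Qed.

Fact teq_sym : symmetric teq.
Proof.
by move=> s t; apply/teqP/teqP => h W f fb; rewrite h.
Qed.

Fact teq_trans : transitive teq.
Proof.
by move=> t s r /teqP h1 /teqP h2; apply/teqP => W f fb; rewrite h1 ?h2.
Qed.

Canonical teq_equiv := EquivRel teq teq_refl teq_sym teq_trans.

Definition tensor : Type := {eq_quot teq_equiv}.
HB.instance Definition _ := Choice.on tensor.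
HB.instance Definition _ := EqQuotient.on tensor.

Lemma teq_pi s t : teq s t -> \pi_tensor s = \pi_tensor t.
Proof. by move=> st; apply/eqmodP. Qed.

Lemma teq_repr s : teq (repr (\pi_tensor s)) s.
Proof. by have /eqmodP := reprK (\pi_tensor s). Qed.

Definition tlift (W : lmodType k) (f : U -> V -> W) (t : tensor) : W :=
  teval f (repr t).

Lemma tlift_pi (W : lmodType k) (f : U -> V -> W) s :
  bilin f -> tlift f (\pi_tensor s) = teval f s.
Proof. by move=> fb; have /teqP := teq_repr s; exact. Qed.

Lemma tensorP (x y : tensor) :
  (forall (W : lmodType k) (f : U -> V -> W), bilin f ->
     tlift f x = tlift f y) -> x = y.
Proof.
move=> h; rewrite -[x]reprK -[y]reprK; apply/teq_pi/teqP => W f fb.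
exact: h.
Qed.

Definition tadd (x y : tensor) : tensor := \pi_tensor (repr x ++ repr y).
Definition tzero : tensor := \pi_tensor [::].
Definition tscale (a : k) (x : tensor) : tensor :=
  \pi_tensor [seq (a *: p.1, p.2) | p <- repr x].
Definition topp (x : tensor) : tensor := tscale (-1) x.

Section Eval.
Variables (W : lmodType k) (f : U -> V -> W) (fb : bilin f).

Lemma tlift_add x y : tlift f (tadd x y) = tlift f x + tlift f y.
Proof. by rewrite tlift_pi // /teval big_cat. Qed.

Lemma tlift_zero : tlift f tzero = 0.
Proof. by rewrite tlift_pi // /teval big_nil. Qed.

Lemma tlift_scale a x : tlift f (tscale a x) = a *: tlift f x.
Proof.
rewrite tlift_pi // /teval big_map scaler_sumr; apply: eq_bigr => p _ /=.
have f0 : f 0 p.2 = 0.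
  by have := fb.1 p.2 (-1) 0 0; rewrite scaler0 addr0 scaleN1r addNr.
by have := fb.1 p.2 a p.1 0; rewrite !addr0 f0 addr0.
Qed.

End Eval.

Fact taddA : associative tadd.
Proof. by move=> x y z; apply: tensorP => W f fb; rewrite !tlift_add ?addrA. Qed.

Fact taddC : commutative tadd.
Proof. by move=> x y; apply: tensorP => W f fb; rewrite !tlift_add // addrC. Qed.

Fact tadd0 : left_id tzero tadd.
Proof.
by move=> x; apply: tensorP => W f fb; rewrite tlift_add // tlift_zero // add0r.
Qed.

Fact taddN : left_inverse tzero topp tadd.
Proof.
move=> x; apply: tensorP => W f fb.
by rewrite tlift_add // tlift_scale // tlift_zero // scaleN1r addNr.
Qed.

HB.instance Definition _ := GRing.isZmodule.Build tensor taddA taddC tadd0 taddN.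

Fact tscaleA a b x : tscale a (tscale b x) = tscale (a * b) x.
Proof. by apply: tensorP => W f fb; rewrite !tlift_scale // scalerA. Qed.

Fact tscale1 : left_id 1 tscale.
Proof. by move=> x; apply: tensorP => W f fb; rewrite tlift_scale // scale1r. Qed.

Fact tscaleDr : right_distributive tscale +%R.
Proof.
move=> a x y; apply: tensorP => W f fb.
by rewrite !(tlift_scale, tlift_add) // scalerDr.
Qed.

Fact tscaleDl x : {morph tscale^~ x : a b / a + b}.
Proof.
move=> a b; apply: tensorP => W f fb.
by rewrite !(tlift_scale, tlift_add) // scalerDl.
Qed.

HB.instance Definition _ :=
  GRing.Zmodule_isLmodule.Build k tensor tscaleA tscale1 tscaleDr tscaleDl.

Definition tensr (u : U) (v : V) : tensor := \pi_tensor [:: (u, v)].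

Lemma tlift_linear (W : lmodType k) (f : U -> V -> W) :
  bilin f -> linear (tlift f).
Proof. by move=> fb a x y; rewrite tlift_add ?tlift_scale. Qed.

Lemma tliftE (W : lmodType k) (f : U -> V -> W) u v :
  bilin f -> tlift f (tensr u v) = f u v.
Proof. by move=> fb; rewrite tlift_pi // /teval big_seq1. Qed.

Lemma tensr_bilin : bilin tensr.
Proof.
split=> [v a u u'|u a v v']; apply: tensorP => W f fb;
  by rewrite tlift_linear // !tliftE // (fb.1, fb.2).
Qed.

Lemma tensorW (t : tensor) : t = \sum_(p <- repr t) tensr p.1 p.2.
Proof.
apply: tensorP => W f fb; rewrite [LHS]/tlift /teval.
elim: (repr t) => [|p s IHs]; first by rewrite !big_nil (tlift_zero fb).
by rewrite !big_cons (tlift_add fb) tliftE // IHs.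
Qed.

End Tensor.

Arguments tensr {k U V} u v.

Notation "U ⊗ V" := (tensor U V) (at level 40, left associativity) : type_scope.
Notation "u ⊗v v" := (tensr u v) (at level 40, left associativity) : ring_scope.

Section TensorMaps.
Variable k : comPzRingType.

(* f ⊗ g; meaningful when f and g are linear *)
Definition tmap (U V U' V' : lmodType k) (f : U -> U') (g : V -> V') :
    U ⊗ V -> U' ⊗ V' :=
  tlift (fun u v => f u ⊗v g v).

Definition tassoc (U V W : lmodType k) : U ⊗ (V ⊗ W) -> (U ⊗ V) ⊗ W :=
  tlift (fun u => tlift (fun v w => (u ⊗v v) ⊗v w)).

Definition flat (V : lmodType k) : Prop :=
  forall (U U' : lmodType k) (f : {linear U -> U'}),
    injective f -> injective (tmap f (idfun : V -> V)).

End TensorMaps.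

(* A commutative k-algebra is a commutative ring with a ring morphism from k.
   Unlike in the library's comAlgType, it may be the zero ring, so that k may be
   the zero ring. *)
Record comPzAlg (k : comPzRingType) := ComPzAlg {
  alg_ring : comPzRingType;
  alg_map : {rmorphism k -> alg_ring}
}.

Definition alg_sort (k : comPzRingType) (A : comPzAlg k) : Type := alg_ring A.
Coercion alg_sort : comPzAlg >-> Sortclass.

Section AlgebraModule.
Variables (k : comPzRingType) (A : comPzAlg k).

HB.instance Definition _ := GRing.ComPzRing.copy (alg_sort A) (alg_ring A).

Definition alg_scale (a : k) (x : A) : A := (alg_map A a : A) * x.

Fact alg_scaleA a b x : alg_scale a (alg_scale b x) = alg_scale (a * b) x.
Proof. by rewrite /alg_scale rmorphM mulrA. Qed.

Fact alg_scale1 : left_id 1 alg_scale.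
Proof. by move=> x; rewrite /alg_scale rmorph1 mul1r. Qed.

Fact alg_scaleDr : right_distributive alg_scale +%R.
Proof. by move=> a x y; rewrite /alg_scale mulrDr. Qed.

Fact alg_scaleDl x : {morph alg_scale^~ x : a b / a + b}.
Proof. by move=> a b; rewrite /alg_scale rmorphD mulrDl. Qed.

HB.instance Definition _ := GRing.Zmodule_isLmodule.Build k (alg_sort A)
  alg_scaleA alg_scale1 alg_scaleDr alg_scaleDl.

End AlgebraModule.

Section Algebras.
Variable k : comPzRingType.

(* the product of the algebra A ⊗ B *)
Definition tmul (A B : comPzAlg k) (s t : A ⊗ B) : A ⊗ B :=
  tlift (fun (a : A) (b : B) =>
    tlift (fun (a' : A) (b' : B) => (a * a') ⊗v (b * b')) t) s.

Definition finite_type (A : comPzAlg k) : Prop :=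
  exists s : seq A, forall S : {pred A},
    1 \in S -> GRing.linear_closed S -> GRing.mulr_2closed S ->
    {subset s <= S} -> forall x, x \in S.

End Algebras.

(* An affine group scheme over k, given by its coordinate Hopf algebra: the
   comultiplication, counit and antipode are morphisms of k-algebras. *)
Record affine_group_scheme (k : comPzRingType) := AffineGroupScheme {
  coord_ring : comPzAlg k;
  comult : {linear coord_ring -> coord_ring ⊗ coord_ring};
  counit : {linear coord_ring -> k^o};
  antipode : {linear coord_ring -> coord_ring};
  comult1 : comult 1 = (1 : coord_ring) ⊗v (1 : coord_ring);
  comultM : forall x y : coord_ring, comult (x * y) = tmul (comult x) (comult y);
  counit1 : counit 1 = 1;
  counitM : forall x y : coord_ring, counit (x * y) = counit x * counit y;
  antipode1 : antipode 1 = 1;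
  antipodeM : forall x y : coord_ring, antipode (x * y) = antipode x * antipode y;
  comultA : forall x : coord_ring,
    tmap comult idfun (comult x) = tassoc (tmap idfun comult (comult x));
  comult_counitl : forall x : coord_ring, tlift (fun y z : coord_ring => (counit y : k) *: z) (comult x) = x;
  comult_counitr : forall x : coord_ring, tlift (fun y z : coord_ring => (counit z : k) *: y) (comult x) = x;
  comult_antipodel : forall x : coord_ring,
    tlift (fun y z : coord_ring => antipode y * z) (comult x) = (counit x : k) *: (1 : coord_ring);
  comult_antipoder : forall x : coord_ring,
    tlift (fun y z : coord_ring => y * antipode z) (comult x) = (counit x : k) *: (1 : coord_ring)
}.

Section GModules.
Variables (k : comPzRingType) (G : affine_group_scheme k).
Local Notation "k[G]" := (coord_ring G).

Record gmodule := GModule {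
  gmod_sort :> lmodType k;
  coact : {linear gmod_sort -> gmod_sort ⊗ k[G]};
  coactA : forall v, tmap coact idfun (coact v)
                   = tassoc (tmap idfun (comult G) (coact v));
  coact_counit : forall v, tlift (fun w (x : k[G]) => (counit G x : k) *: w) (coact v) = v
}.

Definition equivariant (M N : gmodule) (f : M -> N) : Prop :=
  forall m, coact N (f m) = tmap f idfun (coact M m).

Definition invariant (V : gmodule) (v : V) : Prop := coact V v = v ⊗v (1 : k[G]).

Definition trivial_coact (a : k^o) : k^o ⊗ k[G] := a ⊗v (1 : k[G]).

Fact trivial_coact_linear : linear trivial_coact.
Proof. by move=> a x y; rewrite /trivial_coact (tensr_bilin _ _).1. Qed.

HB.instance Definition _ :=
  GRing.isLinear.Build k k^o (k^o ⊗ k[G]) *:%R trivial_coact trivial_coact_linear.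

Fact tmap_bilin (U V U' V' : lmodType k) (f : {linear U -> U'})
  (g : {linear V -> V'}) : bilin (fun u v => f u ⊗v g v).
Proof.
by split=> [v a u u'|u a v v']; rewrite linearP ((tensr_bilin _ _).1, (tensr_bilin _ _).2).
Qed.

Fact trivial_coactA a : tmap trivial_coact idfun (trivial_coact a)
  = tassoc (tmap idfun (comult G) (trivial_coact a)).
Proof.
rewrite /tmap /trivial_coact !tliftE; last 2 first.
- exact: (tmap_bilin idfun (comult G)).
- exact: (tmap_bilin trivial_coact idfun).
have assoc_bilin (U V W : lmodType k) (u : U) :
    bilin (fun (v : V) (w : W) => (u ⊗v v) ⊗v w).
  split=> [w b v v'|v b w w']; last by rewrite (tensr_bilin _ _).2.
  by rewrite (tensr_bilin _ _).2 (tensr_bilin _ _).1.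
rewrite /= comult1 /tassoc !tliftE //.
split=> [t b u u'|u b t t']; last by rewrite tlift_linear.
rewrite [t]tensorW; elim: (repr t) => [|p s IHs].
  by rewrite big_nil /= !(tlift_zero (assoc_bilin _ _ _ _)) scaler0 addr0.
rewrite big_cons !(tlift_add (assoc_bilin _ _ _ _)) /= IHs.
rewrite !(tliftE _ _ (assoc_bilin _ _ _ _)) !(tensr_bilin _ _).1.
by rewrite scalerDr addrACA.
Qed.

Fact trivial_coact_counit a :
  tlift (fun (w : k^o) (x : k[G]) => (counit G x : k) *: w) (trivial_coact a) = a.
Proof.
rewrite tliftE ?counit1 ?scale1r //.
split=> [x b u u'|u b x x'].
  by rewrite scalerDr !scalerA mulrC.
by rewrite linearP scalerDl scalerA.
Qed.

Definition trivial_gmodule : gmodule :=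
  @GModule k^o trivial_coact trivial_coactA trivial_coact_counit.

(* C is G-stable when the coaction maps C into the image of C ⊗ k[G] *)
Definition gstable (M : gmodule) (C : {pred M}) : Prop :=
  forall c, c \in C -> exists2 s : seq (M * k[G]),
    {in s, forall p, p.1 \in C} & coact M c = \sum_(p <- s) p.1 ⊗v p.2.

Definition ker_has_stable_complement (M N : gmodule) (f : M -> N) : Prop :=
  exists C : {pred M},
    [/\ GRing.submod_closed C, gstable C,
        forall m, f m = 0 -> m \in C -> m = 0
      & forall m, exists x y, [/\ f x = 0, y \in C & m = x + y]].

Definition power_reductive_degree1 : Prop :=
  forall (M : gmodule) (phi : {linear M -> trivial_gmodule}),
    equivariant phi -> (forall a, exists m, phi m = a) ->
    ker_has_stable_complement phi.

Definition injective_gmodule (I : gmodule) : Prop :=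
  forall (M N : gmodule) (i : {linear M -> N}) (f : {linear M -> I}),
    equivariant i -> injective i -> equivariant f ->
    exists2 g : {linear N -> I}, equivariant g & forall m, g (i m) = f m.

Record injective_resolution (V : gmodule) := InjectiveResolution {
  res_obj : nat -> gmodule;
  res_aug : {linear V -> res_obj 0};
  res_diff : forall n, {linear res_obj n -> res_obj n.+1};
  res_injective : forall n, injective_gmodule (res_obj n);
  res_aug_equivariant : equivariant res_aug;
  res_diff_equivariant : forall n, equivariant (res_diff n);
  res_aug_inj : injective res_aug;
  res_exact0 : forall x, res_diff 0 x = 0 <-> exists v, res_aug v = x;
  res_exactS : forall n y,
    res_diff n.+1 y = 0 <-> exists x, res_diff n x = y
}.

(* H^1 of the complex of invariants of an injective resolution is zero *)
Definition H1_eq0 (V : gmodule) (I : injective_resolution V) : Prop :=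
  forall y : res_obj I 1, invariant y -> res_diff I 1 y = 0 ->
    exists2 x : res_obj I 0, invariant x & res_diff I 0 x = y.

(* The first right derived functor of the invariants does not depend on the
   injective resolution used to compute it; for flat G every G-module has
   one. *)
Definition linearly_reductive : Prop :=
  forall (V : gmodule) (I : injective_resolution V), H1_eq0 I.

End GModules.

(* Main.v *)
(* (a) => (b): let y in I_1 be an invariant cocycle of an injective resolution of
   V, with y = d x.  Flatness makes the kernel P of the map (z, a) |-> d z - a y
   from I_0 (+) k to I_1 a G-module; it projects onto k, and a G-stable
   complement of the kernel of this projection contains an invariant (z, 1), so
   that d z = y.
   (b) => (a): given phi : M -> k onto, with kernel N and phi m = 1, take an
   injective resolution I of N and extend N -> I_0 to g : M -> I_0.  As
   coact m - m ⊗ 1 comes from N ⊗ k[G], d (g m) is an invariant cocycle, hence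
   d (g m) = d x with x invariant, and g m - x comes from some n in N.  Since
   N ⊗ k[G] -> I_0 ⊗ k[G] is injective, m - n is invariant, and it spans a
   complement of N.
   The resolution exists because V embeds in E ⊗ k[G], where E is an injective
   k-module containing V, namely a product of copies of Hom_Z(k, Q/Z). *)
Require Import Defs.
From HB Require Import structures.
From mathcomp Require Import all_boot all_algebra.
From mathcomp Require Import boolp classical_sets functions ring_quotient.

Set Implicit Arguments.
Unset Strict Implicit.
Unset Printing Implicit Defensive.

Import GRing.Theory Num.Theory.
Local Open Scope ring_scope.
Local Open Scope quotient_scope.

(** * Functoriality, associativity and extensionality of tensor products *)

Section TensorTheory.
Variable k : comPzRingType.
Implicit Types U V W A : lmodType k.

Lemma tensor_ind U V (P : U ⊗ V -> Prop) :
  P 0 -> (forall x y, P x -> P y -> P (x + y)) ->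
  (forall u v, P (u ⊗v v)) -> forall t, P t.
Proof.
move=> P0 PD Pt t; rewrite [t]tensorW.
by elim: (repr t) => [|p s IHs]; rewrite ?big_nil ?big_cons //; apply: PD.
Qed.

Lemma tensor_ext U V W (f g : {linear U ⊗ V -> W}) :
  (forall u v, f (u ⊗v v) = g (u ⊗v v)) -> f =1 g.
Proof.
move=> fg; elim/tensor_ind => [|x y fx fy|//]; first by rewrite !linear0.
by rewrite !linearD fx fy.
Qed.

HB.instance Definition _ U V (u : U) :=
  GRing.isLinear.Build k V (U ⊗ V) *:%R (tensr u) ((tensr_bilin U V).2 u).

Definition tensl U V (v : V) (u : U) : U ⊗ V := u ⊗v v.
HB.instance Definition _ U V (v : V) :=
  GRing.isLinear.Build k U (U ⊗ V) *:%R (@tensl U V v) ((tensr_bilin U V).1 v).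

HB.instance Definition _ U V U' V' (f : {linear U -> U'}) (g : {linear V -> V'}) :=
  GRing.isLinear.Build k (U ⊗ V) (U' ⊗ V') *:%R (tmap f g)
    (tlift_linear (tmap_bilin f g)).

Lemma tmapE U V U' V' (f : {linear U -> U'}) (g : {linear V -> V'}) u v :
  tmap f g (u ⊗v v) = f u ⊗v g v.
Proof. exact/tliftE/tmap_bilin. Qed.

Lemma tmap_comp U V U' V' U2 V2 (f : {linear U -> U'}) (g : {linear V -> V'})
    (f' : {linear U' -> U2}) (g' : {linear V' -> V2}) t :
  tmap f' g' (tmap f g t) = tmap (f' \o f) (g' \o g) t.
Proof.
move: t; apply: (tensor_ext (f := tmap f' g' \o tmap f g)
  (g := tmap (f' \o f) (g' \o g))) => u v /=.
by rewrite !tmapE.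
Qed.

Lemma tmap_id U V t : tmap (idfun : U -> U) (idfun : V -> V) t = t.
Proof.
move: t; apply: (tensor_ext (f := tmap idfun idfun) (g := idfun)) => u v /=.
by rewrite tmapE.
Qed.

Lemma tassoc_bilinr U V W (u : U) :
  bilin (fun (v : V) (w : W) => (u ⊗v v) ⊗v w).
Proof.
split=> [w b v v'|v b w w']; last by rewrite linearP.
by rewrite linearP ((tensr_bilin _ _).1 w).
Qed.

Arguments tassoc_bilinr {U V W} u.

Lemma tassoc_bilin U V W :
  bilin (fun u : U => tlift (fun (v : V) (w : W) => (u ⊗v v) ⊗v w)).
Proof.
split=> [t b u u'|u b t t']; last by rewrite tlift_linear //; apply: tassoc_bilinr.
elim/tensor_ind: t => [|x y xE yE|v w].
- by rewrite !(tlift_zero (tassoc_bilinr _)) scaler0 addr0.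
- by rewrite !(tlift_add (tassoc_bilinr _)) xE yE scalerDr addrACA.
- by rewrite !(tliftE _ _ (tassoc_bilinr _)) !(tensr_bilin _ _).1.
Qed.

HB.instance Definition _ U V W :=
  GRing.isLinear.Build k (U ⊗ (V ⊗ W)) ((U ⊗ V) ⊗ W) *:%R (@tassoc k U V W)
    (tlift_linear (tassoc_bilin U V W)).

Lemma tassocE U V W (u : U) (t : V ⊗ W) :
  tassoc (u ⊗v t) = tmap (tensr u) idfun t.
Proof. exact: tliftE (tassoc_bilin _ _ _). Qed.

Lemma tassoc_nat U V W U' V' W' (f : {linear U -> U'}) (g : {linear V -> V'})
    (h : {linear W -> W'}) t :
  tmap (tmap f g) h (tassoc t) = tassoc (tmap f (tmap g h) t).
Proof.
move: t; apply: (tensor_ext (f := tmap (tmap f g) h \o @tassoc k U V W)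
  (g := @tassoc k _ _ _ \o tmap f (tmap g h))) => u t /=.
rewrite !tmapE !tassocE !tmap_comp.
by congr (tmap _ _ t); apply: funext => x /=; rewrite tmapE.
Qed.

End TensorTheory.

(** * Kernels and cokernels of linear maps as modules *)

Section KernelCokernel.
Variables (k : comPzRingType) (U V : lmodType k) (f : {linear U -> V}).

Definition kerp : {pred U} := [pred x | f x == 0].

Fact kerp_submod_closed : GRing.submod_closed kerp.
Proof.
split=> [|a x y]; rewrite !inE ?linear0 // linearP.
by move=> /eqP-> /eqP->; rewrite scaler0 addr0.
Qed.

HB.instance Definition _ := GRing.isSubmodClosed.Build k U kerp kerp_submod_closed.

Definition kermod : Type := {x : U | x \in kerp}.
HB.instance Definition _ := [isSub of kermod for @sval _ _].
HB.instance Definition _ := [Choice of kermod by <:].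
HB.instance Definition _ := [SubChoice_isSubLmodule of kermod by <:].

Definition kincl : {linear kermod -> U} := val.

Lemma kincl_inj : injective kincl.
Proof. exact: val_inj. Qed.

Lemma kinclK x : f (kincl x) = 0.
Proof. exact/eqP/(valP x). Qed.

Lemma kinclP x : f x = 0 -> exists y, kincl y = x.
Proof. by move=> /eqP fx; exists (exist _ x fx). Qed.

Definition imp : {pred V} := [pred y | `[< exists x, f x = y >]].

Fact imp_submod_closed : GRing.submod_closed imp.
Proof.
split=> [|a x y]; rewrite !unfold_in; first by apply/asboolP; exists 0; rewrite linear0.
move=> /asboolP[u <-] /asboolP[v <-]; apply/asboolP.
by exists (a *: u + v); rewrite linearP.
Qed.

HB.instance Definition _ := GRing.isSubmodClosed.Build k V imp imp_submod_closed.

(** The quotient carries only the structure of an abelian group; the action of [k] is put on it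
    below through representatives. *)
Definition coker : Type := {ideal_quot imp}.
HB.instance Definition _ := GRing.Zmodule.on coker.

Lemma impP (y : V) : reflect (exists x, f x = y) (y \in imp).
Proof. exact: asboolP. Qed.

Definition cprojf (y : V) : coker := \pi_({ideal_quot imp}) y.

Lemma cprojf_eq y z : cprojf y = cprojf z <-> exists x, f x = y - z.
Proof.
split=> [/eqP|/impP yz]; first by rewrite -(Quotient.idealrBE imp) => /impP.
by apply/eqP; rewrite -(Quotient.idealrBE imp).
Qed.

Definition cscale (a : k) (q : coker) : coker := cprojf (a *: repr (q : {ideal_quot imp})).

Lemma cprojf_surj q : cprojf (repr (q : {ideal_quot imp})) = q.
Proof. exact: reprK. Qed.

Lemma cprojfD y z : cprojf (y + z) = cprojf y + cprojf z.
Proof. exact: (raddfD \pi_({ideal_quot imp})). Qed.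

Lemma cscaleE a y : cscale a (cprojf y) = cprojf (a *: y).
Proof.
rewrite /cscale; apply/cprojf_eq.
have /cprojf_eq[x fx] := cprojf_surj (cprojf y).
by exists (a *: x); rewrite linearZ /= fx scalerBr.
Qed.

Fact cscaleA a b x : cscale a (cscale b x) = cscale (a * b) x.
Proof. by rewrite -[x]cprojf_surj !cscaleE scalerA. Qed.

Fact cscale1 : left_id 1 cscale.
Proof. by move=> x; rewrite -[x]cprojf_surj !cscaleE scale1r. Qed.

Fact cscaleDr : right_distributive cscale +%R.
Proof.
move=> a x y; rewrite -[x]cprojf_surj -[y]cprojf_surj.
by rewrite !(=^~ cprojfD, cscaleE) scalerDr.
Qed.

Fact cscaleDl x : {morph cscale^~ x : a b / a + b}.
Proof.
by move=> a b; rewrite -[x]cprojf_surj !(=^~ cprojfD, cscaleE) scalerDl.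
Qed.

HB.instance Definition _ :=
  GRing.Zmodule_isLmodule.Build k coker cscaleA cscale1 cscaleDr cscaleDl.

Fact cprojf_linear : linear cprojf.
Proof. by move=> a y z; rewrite cprojfD -cscaleE. Qed.

HB.instance Definition _ := GRing.isLinear.Build k V coker *:%R cprojf cprojf_linear.

Definition cproj : {linear V -> coker} := cprojf.

Lemma cproj_surj q : exists y, cproj y = q.
Proof. by exists (repr (q : {ideal_quot imp})); apply: cprojf_surj. Qed.

Lemma cproj0P y : cproj y = 0 <-> exists x, f x = y.
Proof. by rewrite -(linear0 cproj) [_ = _]cprojf_eq subr0. Qed.

Lemma cprojK x : cproj (f x) = 0.
Proof. by apply/cproj0P; exists x. Qed.

Section Factor.
Variables (W : lmodType k) (g : {linear V -> W}).
Hypothesis gf0 : forall x, g (f x) = 0.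

(** [g] is constant on classes, so evaluating it at representatives defines [h]. The last clause
    covers the exact case, where [h] embeds the cokernel into [W]. *)
Lemma coker_factor : exists2 h : {linear coker -> W}, forall y, h (cproj y) = g y
  & (forall y, g y = 0 -> exists x, f x = y) -> injective h.
Proof.
pose h0 (q : coker) := g (repr (q : {ideal_quot imp})).
have h0E y : h0 (cproj y) = g y.
  have /cprojf_eq[x fx] := cprojf_surj (cproj y).
  by apply/eqP; rewrite -subr_eq0 -linearB -fx gf0.
have h0_lin : linear h0.
  move=> a q r; have [[y <-] [z <-]] := (cproj_surj q, cproj_surj r).
  by rewrite -linearP !h0E linearP.
pose hM := GRing.isLinear.Build k coker W *:%R h0 h0_lin.
pose h : {linear coker -> W} := HB.pack h0 hM.
exists h => [//|ker_g]; apply: raddf_inj => q.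
have [y <-] := cproj_surj q => hy0.
by apply/cproj0P/ker_g; rewrite -h0E; exact: hy0.
Qed.

End Factor.
End KernelCokernel.

(** * Right exactness of the tensor product, and preservation of kernels under flatness *)

Section Exactness.
Variable k : comPzRingType.
Implicit Types U V W A : lmodType k.

(** Right exactness. For fixed [a], the class of [y ⊗v a] modulo the image of [F] depends only on
    the class of [y] modulo the image of [f]. This yields a map [L] from [coker f ⊗ A] to [coker F]
    through which the projection [cproj F] factors, so [t] has class zero as soon as its image in
    [coker f ⊗ A] vanishes. *)
Lemma tmap_cproj0 U V A (f : {linear U -> V}) t :
  tmap (cproj f) (idfun : A -> A) t = 0 ->
  exists s, tmap f (idfun : A -> A) s = t.
Proof.
set F := tmap f (idfun : A -> A).
move=> t0; apply/(cproj0P F).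
pose B0 (a : A) := cproj F \o @tensl k V A a.
have B0f a x : B0 a (f x) = 0.
  by rewrite /B0 /= -[tensl _ _]/(f x ⊗v idfun a) -tmapE cprojK.
have Bex a : {h : {linear coker f -> coker F} | forall y, h (cproj f y) = cproj F (y ⊗v a)}.
  by apply: cid; have [h hE _] := coker_factor (B0f a); exists h.
pose B q a := sval (Bex a) q.
have B_E y a : B (cproj f y) a = cproj F (y ⊗v a) by exact: svalP (Bex a) y.
have B_bilin : bilin B.
  split=> [a b q r|q b a a']; first by rewrite /B linearP.
  by have [y <-] := cproj_surj q; rewrite !B_E !linearP.
pose L : {linear coker f ⊗ A -> coker F} :=
  HB.pack (tlift B) (GRing.isLinear.Build k _ _ *:%R _ (tlift_linear B_bilin)).
have LE : L \o tmap (cproj f) idfun =1 cproj F.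
  by apply: tensor_ext => y a /=; rewrite tmapE tliftE.
by rewrite -LE /= t0; apply: (linear0 L).
Qed.

(** [f] factors through an injection [h] of the cokernel of [kincl f] into [V]. By flatness [h]
    stays injective after tensoring with [A], so [t] already dies in that cokernel tensored with
    [A], and right exactness applies. *)
Lemma tmap_ker U V A (f : {linear U -> V}) t : flat A ->
  tmap f (idfun : A -> A) t = 0 ->
  exists s, tmap (kincl f) (idfun : A -> A) s = t.
Proof.
move=> flatA ft0; apply: tmap_cproj0.
have [h hE h_inj] := coker_factor (@kinclK _ _ _ f).
apply: (flatA _ _ h); first by apply: h_inj => y /kinclP.
rewrite tmap_comp linear0 -[RHS]ft0.
by congr (tmap _ _ t); apply: funext => y /=; rewrite hE.
Qed.

End Exactness.

(** * Extension of additive maps into a divisible group *)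

Section Divisible.

Lemma int_subgroup (S : int -> Prop) :
  S 0 -> (forall i j, S i -> S j -> S (i - j)) ->
  exists q : nat, forall j, S j <-> (q %| j)%Z.
Proof.
move=> S0 SB.
have SN i : S i -> S (- i) by rewrite -sub0r; apply: SB.
have SD i j : S i -> S j -> S (i + j) by move=> Si /SN; rewrite -{2}[j]opprK; apply: SB.
have SM i j : S i -> S (j * i).
  move=> Si; have SMn n : S (n%:Z * i).
    by elim: n => [|n IHn]; rewrite ?mul0r // intS mulrDl mul1r; apply: SD.
  by case: j => n //; rewrite NegzE mulNr; apply/SN.
(* The generator is the least positive element, by Euclidean division; if there is none, the
   subgroup is zero and [q] is 0, whose only multiple is 0. *)
have [|noS] := pselect (exists q, (0 < q)%N && `[< S q%:Z >]).
  move=> /ex_minnP[q /andP[q_gt0 /asboolP Sq] q_min]; exists q => j.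
  split=> [Sj|/dvdzP[i ->]]; last exact: SM.
  have : S (j %% q)%Z by rewrite /modz; apply: SB => //; apply: SM.
  have r_lt : ((j %% q)%Z < q%:Z)%R by exact: ltz_pmod.
  have r_ge0 : (0 <= (j %% q)%Z)%R by apply: modz_ge0; rewrite -lt0n.
  move=> Sr; apply/dvdz_mod0P; case: (j %% q)%Z r_lt r_ge0 Sr => // -[] // r r_lt _ Sr.
  have := q_min r.+1; rewrite /= => /(_ (introT (asboolP _) Sr)).
  by rewrite leqNgt -ltz_nat r_lt.
exists 0 => j; rewrite dvd0z; split=> [Sj|/eqP-> //].
apply/eqP; apply: contrapT => j0; apply: noS.
exists `|j|%N; rewrite absz_gt0; apply/andP; split; first exact/eqP.
apply/asboolP; case: j Sj {j0} => n //.
by rewrite NegzE => /SN; rewrite opprK abszN.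
Qed.

Variables (N D : zmodType).
Hypothesis D_div : forall (d : D) n, (0 < n)%N -> exists d', d' *+ n = d.

(** An additive map from a subgroup of [N] to [D], encoded by its graph; the last condition is
    single-valuedness at 0, hence everywhere. *)
Definition partial_hom (G : set (N * D)) :=
  [/\ G 0, forall p q, G p -> G q -> G (p - q) & forall d, G (0, d) -> d = 0].

Lemma partial_homMz G p j : partial_hom G -> G p -> G (p *~ j).
Proof.
move=> [G0 GB _] Gp.
have GN q : G q -> G (- q) by rewrite -sub0r; apply: GB.
have GD q r : G q -> G r -> G (q + r).
  by move=> Gq /GN; rewrite -{2}[r]opprK; apply: GB.
have GMn n : G (p *+ n) by elim: n => [|n IHn]; rewrite ?mulr0n // mulrS; apply: GD.
by case: j => n; rewrite ?NegzE ?mulrNz -pmulrn //; apply/GN.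
Qed.

(* The multiples of [n] on which [G] is defined form a subgroup of the integers;
   divisibility makes the value on its generator a multiple. *)
Lemma partial_hom_value G n : partial_hom G ->
  exists d, forall j e, G (n *~ j, e) -> e = d *~ j.
Proof.
move=> Gh; have [G0 GB Gf] := Gh.
have [||q qP] := @int_subgroup (fun j => exists e, G (n *~ j, e)).
- by exists 0.
- by move=> i j [e Ge] [e' Ge']; exists (e - e'); rewrite mulrzBr; exact: GB Ge Ge'.
have /qP[e0 Ge0] : (q %| q%:Z)%Z by apply: dvdzz.
have [d dE] : exists d, d *~ q = e0.
  (* If [q] is 0, single-valuedness forces [e0 = 0], and the value 0 serves. *)
  case: (posnP q) => [q0|q_gt0]; last by have [d <-] := D_div e0 q_gt0; exists d.
  by exists 0; move: Ge0; rewrite q0 mulr0z => /Gf ->; rewrite mulr0z.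
exists d => j e Ge; have /dvdzP[i ji] : (q %| j)%Z by apply/qP; exists e.
apply/eqP; rewrite -subr_eq0; apply/eqP/Gf.
suff -> : (0, e - d *~ j) = (n *~ j, e) - (n *~ q, e0) *~ i.
  by apply: GB => //; apply: partial_homMz.
have pairMz (p : N * D) m : p *~ m = (p.1 *~ m, p.2 *~ m).
  by rewrite [LHS]surjective_pairing !(raddfMz fst, raddfMz snd).
by rewrite pairMz ji /= -dE -!mulrzA ![(i * _)%R]mulrC; congr pair; rewrite /= subrr.
Qed.

(** Divisible groups are injective over the integers: a maximal graph containing [G], given by
    Zorn's lemma, is defined on all of [N]. *)
Lemma partial_hom_extend G : partial_hom G ->
  exists g : {additive N -> D}, forall p, G p -> g p.1 = p.2.
Proof.
move=> Gh.
pose P (A : set (N * D)) := A = set0 \/ partial_hom A /\ (G `<=` A)%classic.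
have Pne A p : P A -> A p -> partial_hom A /\ (G `<=` A)%classic.
  by case=> // ->.
have [F FP Ftot|A [PA Amax]] := @Zorn_bigcup _ P.
  have [[X FX [p Xp]]|Fe] := pselect (exists2 X, F X & exists p, X p); last first.
    left; apply/seteqP; split=> // p [X FX Xp].
    by case: Fe; exists X => //; exists p.
  have [Xh GX] := Pne _ _ (FP _ FX) Xp.
  right; split; last by move=> q /GX Xq; exists X.
  split=> [|q r [Y FY Yq] [Z FZ Zr]|d [Y FY Yd]].
  - by exists X => //; case: Xh.
  - have [YZ|ZY] := Ftot _ _ FY FZ.
      by exists Z => //; have [[_ ZB _] _] := Pne _ _ (FP _ FZ) Zr; apply: ZB => //; apply: YZ.
    by exists Y => //; have [[_ YB _] _] := Pne _ _ (FP _ FY) Yq; apply: YB => //; apply: ZY.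
  - by have [[_ _ Yf] _] := Pne _ _ (FP _ FY) Yd; apply: Yf.
have [Ah GA] : partial_hom A /\ (G `<=` A)%classic.
  case: PA => // A0; case: (Amax G); last by right; split.
  rewrite A0; split; first exact: sub0set.
  by case: Gh => G0 _ _ /(_ _ G0).
have [A0 AB Af] := Ah.
have Atot n : exists d, A (n, d).
  apply: contrapT => nA; have [d dP] := partial_hom_value n Ah.
  (* [B] is the graph generated by [A] and the new pair [(n, d)]; it contradicts maximality. *)
  pose B := [set p | exists2 q, A q & exists j, p = q + (n, d) *~ j]%classic.
  have AleB : (A `<=` B)%classic by move=> p Ap; exists p => //; exists 0; rewrite mulr0z addr0.
  apply: (Amax B).
    split=> // /(_ (n, d)) BA; apply: nA; exists d; apply: BA.
    by exists 0 => //; exists 1; rewrite add0r.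
  right; split; last exact: subset_trans AleB.
  split=> [|p q [p' Ap' [i ->]] [q' Aq' [j ->]]|e [p Ap [j pE]]].
  - exact: AleB.
  - exists (p' - q'); first exact: AB.
    by exists (i - j); rewrite mulrzBr opprD addrACA.
  (* Single-valuedness of [B]: if [(0, e)] is [p + (n, d) *~ j], then [- p] lies in [A] over
     [n *~ j], so by the choice of [d] its value is [d *~ j], which gives [e = 0]. *)
  - have pairMz : (n, d) *~ j = (n *~ j, d *~ j).
      by rewrite [LHS]surjective_pairing !(raddfMz fst, raddfMz snd).
    have : A (- p) by rewrite -sub0r; apply: AB.
    move: pE; rewrite pairMz; case: p {Ap} => x y [xE ->].
    have -> : - (x, y) = (n *~ j, - y).
      by congr pair; apply/eqP; rewrite eq_sym -addr_eq0 addrC -xE.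
    by move=> /dP <-; rewrite subrr.
pose g0 n := sval (cid (Atot n)).
have Ag0 n : A (n, g0 n) by exact: svalP (cid (Atot n)).
have g0E n d : A (n, d) -> g0 n = d.
  move=> And; apply/eqP; rewrite -subr_eq0; apply/eqP/Af.
  by rewrite -[0 in X in A X](subrr n); exact: AB (Ag0 n) And.
have g0B : zmod_morphism g0 by move=> x y; apply: g0E; exact: AB (Ag0 x) (Ag0 y).
pose g : {additive N -> D} := HB.pack g0 (GRing.isZmodMorphism.Build N D g0 g0B).
by exists g => -[x y] /GA; apply: g0E.
Qed.

End Divisible.


(** * The divisible group Q/Z and its characters separating points *)

Definition intp : {pred rat} := [pred x | x \is a Num.int].

Fact intp_zmod_closed : zmod_closed intp.
Proof. by split=> [|x y]; rewrite !inE ?rpred0 //; apply: rpredB. Qed.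

HB.instance Definition _ := GRing.isZmodClosed.Build rat intp intp_zmod_closed.

Local Notation QZ := {ideal_quot intp}.

Lemma QZ_div (d : QZ) n : (0 < n)%N -> exists d', d' *+ n = d.
Proof.
move=> n_gt0; exists (\pi_QZ (repr d / n%:R)).
rewrite -raddfMn /= -[RHS]reprK; congr (\pi_QZ _).
by rewrite -[LHS]mulr_natr mulfVK // pnatr_eq0 -lt0n.
Qed.

Lemma QZ_torsion q : q != 1%N -> exists2 d : QZ, d != 0 & d *+ q = 0.
Proof.
move=> q1; have [m m_gt1 qm0] : exists2 m, (1 < m)%N & (m %| q)%N.
  by exists (if q is 0 then 2 else q); case: q q1 => // -[].
exists (\pi_QZ m%:R^-1).
  rewrite -(raddf0 \pi_QZ) -(Quotient.idealrBE intp) subr0 inE.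
  apply/negP => /norm_intr_ge1; rewrite invr_eq0 pnatr_eq0 -lt0n (ltnW m_gt1).
  rewrite normfV normr_nat invf_ge1 ?ltr0n ?(ltnW m_gt1) // => /(_ isT).
  by rewrite lern1 leqNgt m_gt1.
have /dvdnP[r ->] := qm0; rewrite -raddfMn /= -(raddf0 \pi_QZ).
apply/eqP; rewrite -(Quotient.idealrBE intp) subr0 inE.
rewrite -[X in X \is a _]mulr_natr natrM mulrCA mulVf ?mulr1 ?rpred_nat //.
by rewrite pnatr_eq0 -lt0n ltnW.
Qed.

(** If [q] is the order of [v], with 0 for infinite order, sending [v] to a nonzero [d] killed by
    [q] is well defined on the multiples of [v]; this map then extends to [V]. *)
Lemma QZ_separates (V : zmodType) (v : V) : v != 0 ->
  exists g : {additive V -> QZ}, g v != 0.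
Proof.
move=> v0; have [||q qP] := @int_subgroup (fun j => v *~ j = 0).
- by rewrite mulr0z.
- by move=> i j vi vj; rewrite mulrzBr vi vj subr0.
have q1 : q != 1%N.
  by apply: contraNneq v0 => q1; apply/eqP; have /qP : (q %| 1)%Z by rewrite q1.
have [d d0 dq] := QZ_torsion q1.
pose G := [set p : V * QZ | exists j, p = (v *~ j, d *~ j)]%classic.
have [|g gG] := partial_hom_extend QZ_div (G := G).
  split=> [|_ _ [i ->] [j ->]|e [j [/esym/qP/dvdzP[i ->] ->]]].
  - by exists 0; rewrite !mulr0z.
  - by exists (i - j); rewrite !mulrzBr.
  - by rewrite mulrC mulrzA -pmulrn dq mul0rz.
by exists g; have /= -> := gG (v, d) (ex_intro _ 1 erefl).
Qed.

(** * Embedding a [k]-module into an injective one *)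

Section InjectiveHull.
Variable k : comPzRingType.

Definition dualp : {pred k -> QZ} := [pred F | `[< zmod_morphism F >]].

Lemma dualpP F : reflect (zmod_morphism F) (F \in dualp).
Proof. exact: asboolP. Qed.

Fact dualp_zmod_closed : zmod_closed dualp.
Proof.
split=> [|F F' /dualpP FP /dualpP F'P]; apply/dualpP => x y /=.
  by rewrite subr0.
by rewrite !fctE FP F'P opprD addrACA opprD.
Qed.

HB.instance Definition _ := GRing.isZmodClosed.Build (k -> QZ) dualp dualp_zmod_closed.

Definition dual : Type := {F : k -> QZ | F \in dualp}.
HB.instance Definition _ := [isSub of dual for @sval _ _].
HB.instance Definition _ := [Choice of dual by <:].
HB.instance Definition _ := [SubChoice_isSubZmodule of dual by <:].

Definition mkdual F (FP : F \in dualp) : dual := exist (fun F => F \in dualp) F FP.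

Lemma dual_eq (F F' : dual) : val F =1 val F' -> F = F'.
Proof. by move=> FF'; apply/val_inj/funext. Qed.

Lemma dualD (F F' : dual) c : val (F + F') c = val F c + val F' c.
Proof. by rewrite (raddfD (\val : dual -> _)). Qed.

Fact dual_scale_proof a (F : dual) : (fun x => val F (x * a)) \in dualp.
Proof. by apply/dualpP => x y; rewrite mulrBl (dualpP _ (valP F)). Qed.

Definition dual_scale a (F : dual) : dual := mkdual (dual_scale_proof a F).

Lemma dual_scaleE a F c : val (dual_scale a F) c = val F (c * a).
Proof. by []. Qed.

Fact dual_scaleA a b x : dual_scale a (dual_scale b x) = dual_scale (a * b) x.
Proof. by apply: dual_eq => c /=; rewrite mulrA. Qed.

Fact dual_scale1 : left_id 1 dual_scale.
Proof. by move=> x; apply: dual_eq => c /=; rewrite mulr1. Qed.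

Fact dual_scaleDr : right_distributive dual_scale +%R.
Proof. by move=> a x y; apply: dual_eq => c; rewrite !(dualD, dual_scaleE). Qed.

Fact dual_scaleDl x : {morph dual_scale^~ x : a b / a + b}.
Proof.
move=> a b; apply: dual_eq => c; rewrite !(dualD, dual_scaleE) mulrDr.
have /dualpP xP := valP x.
have x0 : val x 0 = 0 by rewrite -{1}(subrr 0) xP subrr.
by rewrite -[c * b]opprK xP -[- (c * b)]sub0r xP x0 sub0r !opprK sub0r opprK.
Qed.

HB.instance Definition _ :=
  GRing.Zmodule_isLmodule.Build k dual dual_scaleA dual_scale1 dual_scaleDr dual_scaleDl.

Lemma dualZ a (F : dual) c : val (a *: F) c = val F (c * a).
Proof. by []. Qed.

Definition injective_module (E : lmodType k) : Prop :=
  forall (M N : lmodType k) (i : {linear M -> N}) (f : {linear M -> E}),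
    injective i -> exists g : {linear N -> E}, forall m, g (i m) = f m.

(** [E] is a product of copies of [dual], one for each character [g] of [V], and [v] goes to the
    family of functions [x] ↦ [g (x *: v)]; characters separate points, so this is injective. [E] is
    injective because a linear map into [dual] amounts to a character, its value at 1, and
    characters extend. No minimality of [E] is claimed. *)
Lemma injective_hull (V : lmodType k) :
  exists (E : lmodType k) (j : {linear V -> E}), injective_module E /\ injective j.
Proof.
pose C := {additive V -> QZ}.
have jP (v : V) (g : C) : (fun x : k => g (x *: v)) \in dualp.
  by apply/dualpP => x y; rewrite scalerBl raddfB.
pose j0 v : C -> dual := fun g => mkdual (jP v g).
have j0_lin : linear j0.
  move=> a u v; apply: funext => g; apply: dual_eq => x; rewrite dualD.
  by rewrite fctE dualZ /= scalerDr scalerA raddfD.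
pose jM := GRing.isLinear.Build k V (C -> dual) *:%R j0 j0_lin.
pose j : {linear V -> (C -> dual)} := HB.pack j0 jM.
exists (C -> dual), j; split; last first.
  apply: raddf_inj => v jv0; apply/eqP; apply: contrapT => /negP/QZ_separates[g].
  suff -> : g v = val (j v g) 1 by rewrite jv0 eqxx.
  by rewrite /= scale1r.
move=> M N i f i_inj.
(* Each coordinate of [f], evaluated at 1, is a character defined on the image of [i]; it is
   extended to [N]. *)
have gex (c : C) : {g : {additive N -> QZ} | forall m, g (i m) = val (f m c) 1}.
  apply: cid; pose G := [set p : N * QZ | exists m, p = (i m, val (f m c) 1)]%classic.
  have [|g gG] := partial_hom_extend QZ_div (G := G).
    split=> [|_ _ [m ->] [m' ->]|d [m [/esym]]].
    - by exists 0; rewrite !linear0.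
    - by exists (m - m'); rewrite !linearB.
    - by rewrite -(linear0 i) => /i_inj-> ->; rewrite linear0.
  by exists g => m; have /= -> := gG (i m, val (f m c) 1) (ex_intro _ m erefl).
have gP n (c : C) : (fun x : k => sval (gex c) (x *: n)) \in dualp.
  by apply/dualpP => x y; rewrite scalerBl raddfB.
pose g0 n : C -> dual := fun c => mkdual (gP n c).
have g0_lin : linear g0.
  move=> a u v; apply: funext => c; apply: dual_eq => x; rewrite dualD.
  by rewrite fctE dualZ /= scalerDr scalerA raddfD.
pose gM := GRing.isLinear.Build k N (C -> dual) *:%R g0 g0_lin.
pose g : {linear N -> (C -> dual)} := HB.pack g0 gM.
exists g => m.
apply: funext => c; apply: dual_eq => x /=.
by rewrite -linearZ (svalP (gex c)) linearZ /= mul1r.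
Qed.

End InjectiveHull.

(** * Cokernels of equivariant maps and cofree [G]-modules *)

Section GModuleTheory.
Variables (k : comPzRingType) (G : affine_group_scheme k).
Local Notation A := (coord_ring G).
Local Notation idA := (idfun : A -> A).
Implicit Types V W M N : lmodType k.

Lemma cmap_bilin V : bilin (fun (w : V) (x : A) => (counit G x : k) *: w).
Proof.
split=> [x a u v|w a x y]; first by rewrite linearP /= scalerA mulrC -scalerA.
by rewrite linearP scalerDl scalerA.
Qed.

(** This is the identity tensored with the counit, read through [V ⊗ k] = [V]. *)
Definition cmap V : V ⊗ A -> V := tlift (fun w x => (counit G x : k) *: w).
HB.instance Definition _ V :=
  GRing.isLinear.Build k (V ⊗ A) V *:%R (@cmap V) (tlift_linear (@cmap_bilin V)).

Lemma cmapE V (w : V) (x : A) : cmap (w ⊗v x) = (counit G x : k) *: w.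
Proof. exact: tliftE (cmap_bilin V). Qed.

Lemma cmap_nat V W (f : {linear V -> W}) t : cmap (tmap f idA t) = f (cmap t).
Proof.
move: t; apply: (tensor_ext (f := @cmap W \o tmap f idA) (g := f \o @cmap V)) => v x /=.
by rewrite tmapE !cmapE linearZ.
Qed.

Lemma tmap_eq0 V W (f : {linear V -> W}) t : (forall v, f v = 0) -> tmap f idA t = 0.
Proof.
move=> f0; elim/tensor_ind: t => [|s t sE tE|v x]; first by rewrite linear0.
  by rewrite linearD /= sE tE addr0.
rewrite tmapE f0; exact: (linear0 (tensl x)).
Qed.

Definition is_coaction V (c : {linear V -> V ⊗ A}) : Prop :=
  (forall v, tmap c idfun (c v) = tassoc (tmap idfun (comult G) (c v))) /\
  (forall v, cmap (c v) = v).

Definition gmodule_of V (c : {linear V -> V ⊗ A}) (cP : is_coaction c) : gmodule G :=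
  GModule cP.1 cP.2.

Lemma coact_inj (M : gmodule G) : injective (coact M).
Proof. exact: can_inj (@coact_counit _ _ M). Qed.

Lemma equivariant_comp (M N P : gmodule G) (f : {linear M -> N}) (g : {linear N -> P}) :
  equivariant f -> equivariant g -> equivariant (g \o f).
Proof. by move=> fE gE m; rewrite gE fE tmap_comp. Qed.

Lemma invariant_equivariant (M N : gmodule G) (f : {linear M -> N}) m :
  equivariant f -> Defs.invariant m -> Defs.invariant (f m).
Proof. by move=> fE mI; rewrite /Defs.invariant fE mI tmapE. Qed.

Lemma coker_gmodule (M N : gmodule G) (f : {linear M -> N}) : equivariant f ->
  exists (Q : gmodule G) (p : {linear N -> Q}),
    [/\ equivariant p, forall q, exists y, p y = q
      & forall y, p y = 0 <-> exists x, f x = y].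
Proof.
move=> fE; pose p := cproj f.
(* The coaction of [N] followed by [p] on the first factor kills the image of [f], hence descends to
   the cokernel; its axioms are then checked on representatives. *)
have [|c cE _] := @coker_factor _ _ _ f _ (tmap p idA \o coact N).
  by move=> x /=; rewrite fE tmap_comp tmap_eq0 // => z; apply: cprojK.
have cP : is_coaction c.
  split=> q; have [y <-] := cproj_surj q; rewrite [c _]cE /=.
    rewrite !tmap_comp.
    have -> : c \o p = tmap p idA \o coact N by apply: funext => z; apply: cE.
    rewrite -(tmap_comp (coact N) idfun) coactA tassoc_nat !tmap_comp.
    by congr (tassoc (tmap _ _ _)); apply: funext => z; apply: tmap_id.
  by rewrite cmap_nat [cmap _]coact_counit.
exists (gmodule_of cP), p; split.
- by move=> y; rewrite [LHS]cE.
- exact: cproj_surj.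
- exact: cproj0P.
Qed.

(** The cofree comodule on [V], that is, the module induced from the trivial subgroup: [G] coacts on
    the factor [A] only. *)
Definition cofree_coact V : V ⊗ A -> (V ⊗ A) ⊗ A :=
  @tassoc k V A A \o tmap idfun (comult G).
HB.instance Definition _ V := GRing.Linear.on (@cofree_coact V).

Lemma cofree_coactE V (v : V) (x : A) :
  cofree_coact (v ⊗v x) = tmap (tensr v) idA (comult G x).
Proof. by rewrite /cofree_coact /= tmapE tassocE. Qed.

Lemma cofree_is_coaction V : is_coaction (@cofree_coact V).
Proof.
split.
  apply: (tensor_ext (f := tmap (@cofree_coact V) idA \o @cofree_coact V)
    (g := @tassoc _ _ _ _ \o (tmap idfun (comult G) \o @cofree_coact V))) => v x /=.
  rewrite !cofree_coactE !tmap_comp.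
  have -> : @cofree_coact V \o tensr v = tmap (tensr v) idA \o comult G.
    by apply: funext => y; apply: cofree_coactE.
  rewrite -(tmap_comp (comult G) idfun) comultA tassoc_nat !tmap_comp.
  by congr (tassoc (tmap _ _ _)); apply: funext => z; apply: tmap_id.
apply: (tensor_ext (f := @cmap _ \o @cofree_coact V) (g := idfun)) => v x /=.
rewrite cofree_coactE cmap_nat; congr (v ⊗v _).
exact: comult_counitr.
Qed.

Definition cofree V : gmodule G := gmodule_of (cofree_is_coaction V).

(** One direction of the adjunction between linear maps [N -> V] and equivariant maps from [N] to
    [cofree V]; the other is composition with [cmap]. *)
Lemma tmap_coact_equivariant (N : gmodule G) V (g : {linear N -> V}) :
  @equivariant _ _ N (cofree V) (tmap g idA \o coact N).
Proof.
move=> n; rewrite -(tmap_comp (coact N) idA (tmap g idA) idA) coactA.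
rewrite tassoc_nat /= /cofree_coact /= !tmap_comp.
by congr (tassoc (tmap _ _ _)); apply: funext => z; rewrite /= tmap_id.
Qed.

(** By the adjunction, it suffices to extend the linear map [cmap \o f] to [N] and to turn the
    extension back into an equivariant map. *)
Lemma cofree_injective V : injective_module V -> injective_gmodule (cofree V).
Proof.
move=> V_inj M N i f iE i_inj fE.
have lb : bilin (fun y z : A => (counit G y : k) *: z).
  split=> [y a u v|u a x y]; last by rewrite scalerDr !scalerA mulrC.
  by rewrite linearP scalerDl scalerA.
have [g gE] := V_inj _ _ i (@cmap V \o f) i_inj.
exists (tmap g idA \o coact N); first exact: tmap_coact_equivariant.
move=> m /=; rewrite iE tmap_comp.
have -> : g \o i = @cmap V \o f by apply: funext => z; apply: gE.
rewrite -(tmap_comp f idA (@cmap V) idA) -fE /= /cofree_coact /=.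
move: (f m); apply: (tensor_ext (f := tmap (@cmap V) idA \o @cofree_coact V)
  (g := idfun)) => v x /=.
rewrite cofree_coactE tmap_comp.
(* With [x] recovered from [comult x] by the left counit, both sides become linear in [comult x], so
   pure tensors suffice. *)
rewrite -[x in RHS]comult_counitl.
elim/tensor_ind: (comult G x) => [|s t sE tE|y z].
- by rewrite (tlift_zero lb) !linear0.
- by rewrite (tlift_add lb) !linearD /= sE tE.
- by rewrite tmapE /= cmapE (tliftE _ _ lb) linearZ; exact: (linearZ_LR (tensl z)).
Qed.

End GModuleTheory.

(** * Kernels of equivariant maps and injective resolutions, for flat [G] *)

Section Resolutions.
Variables (k : comPzRingType) (G : affine_group_scheme k).
Local Notation A := (coord_ring G).
Local Notation idA := (idfun : A -> A).
Hypothesis flatA : flat (coord_ring G).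
Implicit Types M N V : gmodule G.

(** By [tmap_ker] the coaction of [M] sends the kernel into the image of kernel ⊗ [A], and by
    flatness the preimage is unique, hence linear in the element. *)
Lemma ker_gmodule M N (f : {linear M -> N}) : equivariant f ->
  exists (K : gmodule G) (i : {linear K -> M}),
    [/\ equivariant i, injective i & forall x, f x = 0 <-> exists y, i y = x].
Proof.
move=> fE; pose i := kincl f; pose Ti : {linear kermod f ⊗ A -> M ⊗ A} := tmap i idA.
have Ti_inj : injective Ti by apply: flatA; apply: kincl_inj.
have cex (v : kermod f) : {s | Ti s = coact M (i v)}.
  apply/cid/tmap_ker => //.
  by rewrite -fE kinclK linear0.
pose c0 v := sval (cex v).
have c0E v : Ti (c0 v) = coact M (i v) by exact: svalP (cex v).
have c0_lin : linear c0.
  by move=> a u v; apply: Ti_inj; rewrite (linearP Ti) !c0E !linearP.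
pose cM := GRing.isLinear.Build k (kermod f) (kermod f ⊗ A) *:%R c0 c0_lin.
pose c : {linear kermod f -> kermod f ⊗ A} := HB.pack c0 cM.
have cE v : Ti (c v) = coact M (i v) by exact: c0E.
have cP : is_coaction c.
  split=> v; last by apply: kincl_inj; rewrite -cmap_nat cE [LHS]coact_counit.
  (* Coassociativity is compared inside [(M ⊗ A) ⊗ A], where it is that of [M]. *)
  have TTi_inj : injective (tmap Ti idA) by apply: flatA; apply: Ti_inj.
  apply: TTi_inj; rewrite tmap_comp tassoc_nat.
  have -> : Ti \o c = coact M \o i by apply: funext => z; apply: cE.
  rewrite -(tmap_comp i idA (coact M) idA) -/Ti cE coactA -cE tmap_comp tmap_comp.
  by congr (tassoc (tmap _ _ _)); apply: funext => z; rewrite /= tmap_id.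
exists (gmodule_of cP), i; split.
- by move=> v; rewrite -cE.
- exact: kincl_inj.
- by move=> x; split=> [/kinclP //|[y <-]]; apply: kinclK.
Qed.

Lemma enough_injectives V : exists (I : gmodule G) (e : {linear V -> I}),
  [/\ injective_gmodule I, equivariant e & injective e].
Proof.
have [E [j [E_inj j_inj]]] := injective_hull V.
exists (cofree G E), (tmap j idA \o coact V); split.
- exact: cofree_injective.
- exact: tmap_coact_equivariant.
- by apply: inj_comp (@coact_inj _ _ V); apply: flatA.
Qed.

(** One step of a resolution: a short exact sequence from [V] through an injective module to its
    quotient [cos_obj]. *)
Record cosyzygy V := Cosyzygy {
  cos_inj : gmodule G;
  cos_emb : {linear V -> cos_inj};
  cos_obj : gmodule G;
  cos_proj : {linear cos_inj -> cos_obj};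
  cos_injective : injective_gmodule cos_inj;
  cos_emb_equivariant : equivariant cos_emb;
  cos_emb_inj : injective cos_emb;
  cos_proj_equivariant : equivariant cos_proj;
  cos_proj_surj : forall q, exists y, cos_proj y = q;
  cos_exact : forall y, cos_proj y = 0 <-> exists x, cos_emb x = y
}.

Lemma cosyzygy_exists V : inhabited (cosyzygy V).
Proof.
have [I [e [I_inj eE e_inj]]] := enough_injectives V.
have [Q [p [pE p_surj p_ex]]] := coker_gmodule eE.
exact: (inhabits (Cosyzygy I_inj eE e_inj pE p_surj p_ex)).
Qed.

Lemma injective_resolution_exists V : inhabited (injective_resolution V).
Proof.
have cosP W : {c : cosyzygy W | True} by apply: cid; have [c] := cosyzygy_exists W; exists c.
pose cos W : cosyzygy W := sval (cosP W).
(* [C n] is the [n]-th cosyzygy of [V]; the short exact sequences are spliced, each differential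
   being a projection onto [C n.+1] followed by the embedding of it. *)
pose C n := iter n (fun W => cos_obj (cos W)) V.
pose d n : {linear cos_inj (cos (C n)) -> cos_inj (cos (C n.+1))} :=
  cos_emb (cos (C n.+1)) \o cos_proj (cos (C n)).
have d0 n y : d n y = 0 <-> exists x, cos_emb (cos (C n)) x = y.
  rewrite -cos_exact; split=> /= [dy0|->]; last by rewrite linear0.
  by apply: (cos_emb_inj (c := cos (C n.+1))); rewrite dy0 linear0.
constructor; apply: (@InjectiveResolution _ _ V (fun n => cos_inj (cos (C n)))
  (cos_emb (cos V)) d).
- by move=> n; apply: cos_injective.
- exact: cos_emb_equivariant.
- by move=> n; apply: equivariant_comp; [apply: cos_proj_equivariant|apply: cos_emb_equivariant].
- exact: cos_emb_inj.
- exact: (d0 0).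
- move=> n y; rewrite d0; split=> [] [x <-]; last by exists (cos_proj (cos (C n)) x).
  by have [z <-] := cos_proj_surj x; exists z.
Qed.

End Resolutions.

(** * The direct sum of two [G]-modules *)

Section DirectSum.
Variables (k : comPzRingType) (G : affine_group_scheme k) (M N : gmodule G).
Local Notation A := (coord_ring G).
Local Notation idA := (idfun : A -> A).

Definition inl_lin (x : M) : M * N := (x, 0).
Fact inl_lin_linear : linear inl_lin.
Proof. by move=> a x y; congr pair => //; rewrite /= scaler0 addr0. Qed.
HB.instance Definition _ := GRing.isLinear.Build k M (M * N)%type *:%R inl_lin inl_lin_linear.

Definition inr_lin (x : N) : M * N := (0, x).
Fact inr_lin_linear : linear inr_lin.
Proof. by move=> a x y; congr pair => //; rewrite /= scaler0 addr0. Qed.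
HB.instance Definition _ := GRing.isLinear.Build k N (M * N)%type *:%R inr_lin inr_lin_linear.

Definition sum_coact (x : M * N) : (M * N)%type ⊗ A :=
  tmap inl_lin idA (coact M x.1) + tmap inr_lin idA (coact N x.2).

Fact sum_coact_linear : linear sum_coact.
Proof.
by move=> a x y; rewrite /sum_coact /= !linearP /= scalerDr addrACA.
Qed.
HB.instance Definition _ :=
  GRing.isLinear.Build k (M * N)%type ((M * N)%type ⊗ A) *:%R sum_coact sum_coact_linear.

Lemma sum_coact_inl x : sum_coact (inl_lin x) = tmap inl_lin idA (coact M x).
Proof. by rewrite /sum_coact /= !linear0 addr0. Qed.

Lemma sum_coact_inr x : sum_coact (inr_lin x) = tmap inr_lin idA (coact N x).
Proof. by rewrite /sum_coact /= !linear0 add0r. Qed.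

Lemma sum_decomp (z : M * N) : z = inl_lin z.1 + inr_lin z.2.
Proof. by case: z => x y; congr pair; rewrite ?addr0 ?add0r. Qed.

Lemma sum_coactE z : sum_coact z
  = tmap inl_lin idA (coact M z.1) + tmap inr_lin idA (coact N z.2).
Proof. by []. Qed.

Lemma sum_is_coaction : is_coaction sum_coact.
Proof.
split=> z /=; rewrite sum_coactE !linearD /=.
  have coactM (L : gmodule G) (j : {linear L -> (M * N)%type}) x :
    (forall u, sum_coact (j u) = tmap j idA (coact L u)) ->
      tmap sum_coact idA (tmap j idA (coact L x))
        = tassoc (tmap idfun (comult G) (tmap j idA (coact L x))).
    move=> jE; rewrite tmap_comp.
    have -> : sum_coact \o j = tmap j idA \o coact L by apply: funext => u; apply: jE.
    rewrite -(tmap_comp (coact L) idA (tmap j idA) idA) coactA tassoc_nat !tmap_comp.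
    by congr (tassoc (tmap _ _ _)); apply: funext => u; rewrite /= tmap_id.
  by congr (_ + _); apply: coactM => u; [apply: sum_coact_inl|apply: sum_coact_inr].
by rewrite !cmap_nat ![cmap (coact _ _)]coact_counit -sum_decomp.
Qed.

Definition sum_gmodule : gmodule G := gmodule_of sum_is_coaction.

Lemma equivariant_sum (P : gmodule G) (f : {linear sum_gmodule -> P}) :
  (forall x, coact P (f (inl_lin x)) = tmap (f \o inl_lin) idA (coact M x)) ->
  (forall y, coact P (f (inr_lin y)) = tmap (f \o inr_lin) idA (coact N y)) ->
  equivariant f.
Proof.
move=> fl fr z; rewrite [coact _ z]sum_coactE linearD /= !tmap_comp -fl -fr -linearD.
by rewrite -[in RHS](linearD f) -sum_decomp.
Qed.

End DirectSum.

(** * Invariant elements over 1, stable complements, and the two implications *)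

Section Equivalence.
Variables (k : comPzRingType) (G : affine_group_scheme k).
Local Notation A := (coord_ring G).
Local Notation idA := (idfun : A -> A).
Hypothesis flatA : flat (coord_ring G).

Lemma tens1_inj (x y : A) : (1 : k^o) ⊗v x = (1 : k^o) ⊗v y -> x = y.
Proof.
have b : bilin (fun (a : k^o) (z : A) => (a : k) *: z).
  split=> [z a u v|u a z z']; first by rewrite scalerDl scalerA.
  by rewrite scalerDr !scalerA mulrC.
move=> /(congr1 (tlift (fun (a : k^o) (z : A) => (a : k) *: z))).
by rewrite !(tliftE _ _ b) !scale1r.
Qed.

Lemma trivial_scale (M : gmodule G) (phi : {linear M -> trivial_gmodule G}) a m :
  phi (a *: m) = (a * (phi m : k) : k^o).
Proof. exact: linearZ. Qed.

(* A [G]-stable complement of [ker phi] is spanned by any of its elements [c]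
   with [phi c = 1], so that [coact c = c ⊗ h]; applying [phi] gives [h = 1]. *)
Lemma complement_invariant (M : gmodule G) (phi : {linear M -> trivial_gmodule G}) :
  equivariant phi -> (exists m, phi m = 1) -> ker_has_stable_complement phi ->
  exists2 c, Defs.invariant c & phi c = 1.
Proof.
move=> phiE [m phim] [C [[C0 C_lin] C_st C_ker C_dec]].
have [x [c [phix Cc mE]]] := C_dec m.
have phic : phi c = 1 by rewrite -phim mE linearD phix add0r.
exists c => //.
have C1 p : p \in C -> p = (phi p : k) *: c.
  move=> Cp; apply/eqP; rewrite -subr_eq0 addrC -scaleNr; apply/eqP/C_ker; last exact: C_lin.
  by rewrite linearD trivial_scale phic mulr1 addNr.
have [s sC cE] := C_st c Cc.
have {}cE : coact M c = c ⊗v (\sum_(p <- s) (phi p.1 : k) *: p.2).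
  rewrite cE linear_sum /=; apply: eq_big_seq => p /sC /C1 {1}->.
  by rewrite linearZ; apply: (linearZ_LR (tensl p.2)).
rewrite /Defs.invariant cE; congr (_ ⊗v _); apply: tens1_inj.
by have := phiE c; rewrite cE tmapE phic /= => <-.
Qed.

(** The complement is the line spanned by [c]. It is stable because [c] is invariant, and [m] splits
    by subtracting [phi m] times [c]. *)
Lemma invariant_complement (M : gmodule G) (phi : {linear M -> trivial_gmodule G}) c :
  Defs.invariant c -> phi c = 1 -> ker_has_stable_complement phi.
Proof.
move=> cI phic; pose C : {pred M} := [pred m | `[< exists a, m = a *: c >]].
have CP m : reflect (exists a, m = a *: c) (m \in C) by exact: asboolP.
exists C; split.
- split=> [|a x y /CP[b ->] /CP[d ->]]; apply/CP; first by exists 0; rewrite scale0r.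
  by exists (a * b + d); rewrite scalerDl scalerA.
- move=> _ /CP[a ->]; exists [:: (a *: c, 1)]; last first.
    by rewrite big_seq1 linearZ /= cI; symmetry; apply: (linearZ_LR (tensl (1 : A))).
  by move=> p; rewrite inE => /eqP->; apply/CP; exists a.
- move=> m phim /CP[a mE]; move: phim; rewrite mE trivial_scale phic mulr1 => ->.
  by rewrite scale0r.
- move=> m; exists (m - (phi m : k) *: c), ((phi m : k) *: c); split.
  + by rewrite linearB trivial_scale phic mulr1 subrr.
  + by apply/CP; exists (phi m).
  + by rewrite subrK.
Qed.

Lemma power_reductive_H1 : power_reductive_degree1 G -> linearly_reductive G.
Proof.
move=> prG V I y yI dy0; have [x0 x0E] := (res_exactS y).1 dy0.
(* Here [P] is the whole direct sum; the kernel of [u] will be [K]. *)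
pose T := trivial_gmodule G; pose P := sum_gmodule (res_obj I 0) T.
have [u u_E] : exists u : {linear P -> res_obj I 1},
    forall z, u z = res_diff I 0 z.1 - (z.2 : k) *: y.
  pose u0 (z : P) : res_obj I 1 := res_diff I 0 z.1 - (z.2 : k) *: y.
  have u0_lin : linear u0.
    move=> a [x b] [x' b']; rewrite /u0 /= linearP scalerDl -scalerA.
    by rewrite scalerBr opprD addrACA.
  pose uM := GRing.isLinear.Build k P (res_obj I 1) *:%R u0 u0_lin.
  pose u : {linear P -> res_obj I 1} := HB.pack u0 uM.
  by exists u.
have u_l x : u (inl_lin T x) = res_diff I 0 x by rewrite u_E /= scale0r subr0.
have u_r (a : T) : u (inr_lin (res_obj I 0) a) = (- a : k) *: y.
  by rewrite u_E /= linear0 sub0r scaleNr.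
(* On the first summand this is equivariance of the differential, on the second it is the invariance
   of [y]. *)
have uE : equivariant u.
  apply: equivariant_sum => [x|a].
    rewrite u_l res_diff_equivariant; congr (tmap _ _ _).
    by apply: funext => z; exact/esym/u_l.
  rewrite u_r linearZ /= yI -[LHS](linearZ_LR (tensl (1 : A))).
  rewrite -[LHS](congr1 (tensl (1 : A)) (u_r a)).
  exact/esym/(tmapE (u \o inr_lin (res_obj I 0) (N := T)) idA).
have [K [i [iE i_inj iP]]] := ker_gmodule flatA uE.
pose psnd : {linear P -> T} := snd.
have psndE : equivariant psnd.
  have := @equivariant_sum _ _ _ _ T psnd; apply=> [x|a].
    by rewrite tmap_eq0 //; apply: (linear0 (tensl (1 : A))).
  exact/esym/(tmapE (psnd \o inr_lin (res_obj I 0) (N := T)) idA).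
pose pfst : {linear P -> res_obj I 0} := fst.
have pfstE : equivariant pfst.
  have := @equivariant_sum _ _ _ _ _ pfst; apply=> [x|a].
    by rewrite -[LHS]tmap_id.
  by rewrite tmap_eq0 //= linear0.
pose phi : {linear K -> T} := psnd \o i.
have phiE : equivariant phi := equivariant_comp iE psndE.
(* The pair [(a *: x0, a)] is killed by [u] because the differential sends [x0] to [y]. *)
have phi_surj a : exists m, phi m = a.
  have [|m mE] := (iP ((a : k) *: x0, a)).1; last by exists m; rewrite /phi /= mE.
  by rewrite u_E /= linearZ /= x0E subrr.
have [c cI phic] := complement_invariant phiE (phi_surj 1) (prG K phi phiE phi_surj).
exists (pfst (i c)); first exact/(invariant_equivariant pfstE)/(invariant_equivariant iE).
have : u (i c) = 0 by apply/iP; exists c.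
rewrite u_E [(i c).2]phic scale1r => /eqP.
by rewrite subr_eq0 => /eqP.
Qed.

Lemma H1_power_reductive : linearly_reductive G -> power_reductive_degree1 G.
Proof.
move=> lrG M phi phiE phi_surj.
have [N [i [iE i_inj iP]]] := ker_gmodule flatA phiE.
have phi_i n : phi (i n) = 0 by apply/iP; exists n.
have [I] := injective_resolution_exists flatA N.
have [g gE gi] := res_injective iE i_inj (@res_aug_equivariant _ _ _ I).
have [m phim] := phi_surj 1.
(* Equivariance of [phi] makes the difference vanish under [phi] tensored with the identity, so
   [tmap_ker] applies; its answer over [kermod phi] is carried to [N] by the comparison map [j]. *)
have defect z : phi z = 1 -> exists s, tmap i idA s = coact M z - z ⊗v (1 : A).
  move=> phiz; have [|t tE] := @tmap_ker _ _ _ A phi (coact M z - z ⊗v (1 : A)) flatA.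
    by rewrite linearB /= -phiE tmapE phiz subrr.
  have [j0 jE] : exists j0 : kermod phi -> N, forall n, i (j0 n) = kincl phi n.
    have jex n : {n' | i n' = kincl phi n} by apply/cid/iP/kinclK.
    by exists (fun n => sval (jex n)) => n; exact: svalP (jex n).
  have j_lin : linear j0 by move=> a x y; apply: i_inj; rewrite linearP !jE linearP.
  pose jM := GRing.isLinear.Build k _ N *:%R j0 j_lin.
  pose j : {linear kermod phi -> N} := HB.pack j0 jM.
  exists (tmap j idA t); rewrite tmap_comp -tE; congr (tmap _ _ t).
  by apply: funext => n; apply: jE.
pose y := res_diff I 0 (g m).
have aug_diff n : res_diff I 0 (res_aug I n) = 0 by apply/res_exact0; exists n.
(* The defect of [m] comes from [N ⊗ A], and the differential composed with [g] vanishes on [N]. *)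
have yI : Defs.invariant y.
  have [s sE] := defect m phim.
  rewrite /Defs.invariant res_diff_equivariant gE tmap_comp.
  rewrite -[coact M m](subrK (m ⊗v (1 : A))) -sE linearD /= tmapE tmap_comp tmap_eq0 ?add0r // => n /=.
  by rewrite gi aug_diff.
have [|x xI xy] := lrG N I y yI.
  by apply/res_exactS; exists (g m).
have [n nE] : exists n, res_aug I n = g m - x.
  by apply/res_exact0; rewrite linearB xy subrr.
pose c := m - i n.
have phic : phi c = 1 by rewrite linearB phim phi_i subr0.
have gc : g c = x by rewrite linearB gi nE subKr.
have [s sE] := defect c phic.
apply: (@invariant_complement M phi c) => //.
apply/eqP; rewrite -subr_eq0 -sE; suff -> : s = 0 by rewrite linear0.
(* The image of [s] in [res_obj I 0 ⊗ A] is the defect of [g c = x], which is zero since [x] is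
   invariant. *)
have aug_inj : injective (tmap (res_aug I) idA) by apply: flatA; apply: res_aug_inj.
apply: aug_inj; rewrite linear0.
have -> : (res_aug I : _ -> _) = g \o i by apply: funext => z; rewrite /= gi.
by rewrite -(tmap_comp i idA g idA) sE linearB /= -gE gc xI tmapE gc subrr.
Qed.

End Equivalence.

Theorem proposition4p12 (k : comPzRingType) (G : affine_group_scheme k)
  (G_flat : flat (coord_ring G)) (G_algebraic : finite_type (coord_ring G)) :
  power_reductive_degree1 G <-> linearly_reductive G.
Proof.
split; [exact: power_reductive_H1|exact: H1_power_reductive].
Qed.
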